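(* Let $\mathcal{D}=\mathbb{T}$ or $\mathcal{D}=\mathbb{T}^2$, and let $T>0$ be a given final time. Let $a,b\in C^\infty(\mathcal{D};\mathbb{R}^+)$ be two bounded non-degenerate conductivities: $$m:=\min\left\{\inf_{\mathcal{D}}a,\ \inf_{\mathcal{D}}b\right\}>0,\qquad M:=\sup_{\mathcal{D}}\{a+b\}<\infty.$$ Let $u(t,\mathbf{x};a)$ and $u(t,\mathbf{x};b)$ denote the solutions of $$u_t-\nabla\cdot[a(\mathbf{x})\nabla u]=f(t,\mathbf{x})\qquad\text{and}\qquad u_t-\nabla\cdot[b(\mathbf{x})\nabla u]=f(t,\mathbf{x})$$ on $\mathcal{D}$, respectively, with the same inhomogeneous term $f$ and the same initial condition $u_0(\cdot):=u(0,\cdot;a)=u(0,\cdot;b)\in C^\infty(\mathcal{D};\mathbb{R})$. Then $$\|u(t,\mathbf{x};a)-u(t,\mathbf{x};b)\|_{L^2_tL^2_{\mathbf{x}}([0,T]\times\mathcal{D})}\le C\,\|a-b\|_{L^\infty(\mathcal{D})},$$ where the constant $C$ depends only on $\mathcal{D},T,m,M,f,u_0$ (and not otherwise on $a,b$).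
   Context: $\mathbb{T}=\mathbb{R}/\mathbb{Z}$ and $\mathbb{T}^2=\mathbb{R}^2/\mathbb{Z}^2$, so the equations carry periodic boundary conditions. $\nabla$ is the spatial gradient: $\partial_x$ in 1D and $(\partial_x,\partial_y)^\top$ in 2D. The conductivity is independent of time and temperature. The function $f:\mathbb{R}^+\times\mathcal{D}\to\mathbb{R}$ is a given external heat source; $u:\mathbb{R}^+\times\mathcal{D}\to\mathbb{R}$ is the temperature. *)

(* Defs.v *)
From HB Require Import structures.
From mathcomp Require Import all_boot all_order all_algebra.
From mathcomp Require Import all_classical all_reals all_analysis.
Import Order.TTheory GRing.Theory Num.Theory.
Import numFieldNormedType.Exports.

Set Implicit Arguments.
Unset Strict Implicit.
Unset Printing Implicit Defensive.

Local Open Scope classical_set_scope.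
Local Open Scope ring_scope.

(* The domains T = R/Z and T^2 = R^2/Z^2.  A function on the torus of dimension
   n is represented by a Z^n-periodic function on the row vectors 'rV[R]_n. *)
Inductive torus := Torus1 | Torus2.

Definition torus_dim (D : torus) : nat :=
  match D with Torus1 => 1 | Torus2 => 2 end.

Section calculus.
Context {R : realType} {n : nat}.
Implicit Types (i : 'I_n) (g : 'rV[R]_n -> R) (F : 'rV[R]_n -> 'rV[R]_n).

Definition torus_periodic g : Prop := forall x i, g (x + delta_mx 0 i) = g x.

Definition has_partial i g (x : 'rV[R]_n) : Prop :=
  derivable g x (delta_mx 0 i).

Definition partial i g (x : 'rV[R]_n) : R := 'D_(delta_mx 0 i) g x.

Definition gradient g (x : 'rV[R]_n) : 'rV[R]_n := \row_i partial i g x.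

Definition divergence F (x : 'rV[R]_n) : R :=
  \sum_i partial i (fun y => F y 0 i) x.

Definition iter_partial (s : seq 'I_n) g : 'rV[R]_n -> R := foldr partial g s.

Definition smooth g : Prop := forall s : seq 'I_n,
  continuous (iter_partial s g) /\
  (forall i x, has_partial i (iter_partial s g) x).

Definition smooth_torus g : Prop := torus_periodic g /\ smooth g.

(* Joint continuity in (t, x), at every time 0 < t < T. *)
Definition continuous_inside (T : R) (h : R -> 'rV[R]_n -> R) : Prop :=
  forall p : R * 'rV[R]_n, 0 < p.1 < T ->
    {for p, continuous (fun q : R * 'rV[R]_n => h q.1 q.2)}.

(* Classical solutions on [0,T] x D of u_t - div (a grad u) = f, u(0) = u0:
   u is continuous on the closed cylinder, of class C^1 in t and C^2 in x inside
   it, and satisfies the equation pointwise there. *)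
Record heat_solution (T : R) (a : 'rV[R]_n -> R) (f : R -> 'rV[R]_n -> R)
    (u0 : 'rV[R]_n -> R) (u : R -> 'rV[R]_n -> R) : Prop := HeatSolution {
  heat_periodic : forall t, 0 <= t <= T -> torus_periodic (u t);
  heat_continuous :
    {within [set p : R * 'rV[R]_n | 0 <= p.1 <= T],
      continuous (fun p : R * 'rV[R]_n => u p.1 p.2)};
  heat_derivable_t : forall t x, 0 < t < T -> derivable (u^~ x) t 1;
  heat_continuous_t : continuous_inside T (fun t x => derive1 (u^~ x) t);
  heat_derivable_x : forall t x i, 0 < t < T -> has_partial i (u t) x;
  heat_continuous_x : forall i, continuous_inside T (fun t => partial i (u t));
  heat_derivable_xx : forall t x i j, 0 < t < T ->
    has_partial j (partial i (u t)) x;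
  heat_continuous_xx : forall i j,
    continuous_inside T (fun t => partial j (partial i (u t)));
  heat_equation : forall t x, 0 < t < T ->
    derive1 (u^~ x) t - divergence (fun y => a y *: gradient (u t) y) x = f t x;
  heat_initial : forall x, u 0 x = u0 x }.

End calculus.

Section norms.
Context {R : realType}.
Local Notation mu := (@lebesgue_measure R).

Lemma measurable_segment (c : R) :
  measurable (`[0, c] : set (measurableTypeR R)).
Proof. exact: measurable_itv. Qed.

Lemma measurable_square :
  measurable (`[0, 1] `*` `[0, 1] : set (measurableTypeR R * measurableTypeR R)).
Proof. by apply: measurableX; exact: measurable_itv. Qed.

Definition point1 (s : R) : 'rV[R]_1 := \row_(i < 1) s.

Definition point2 (s : R * R) : 'rV[R]_2 :=
  \row_(i < 2) (if i == 0 then s.1 else s.2).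

(* The norms of L^p(D) and L^2(0,T; L^2(D)).  Since [0,1]^n is a fundamental
   domain of R^n / Z^n, the measure of D is Lebesgue measure on that cell. *)
Definition Lx_norm (D : torus) (p : \bar R) :
    ('rV[R]_(torus_dim D) -> R) -> \bar R :=
  match D with
  | Torus1 => fun g =>
      Lnorm (mrestr mu (measurable_segment 1)) p (fun s => (g (point1 s))%:E)
  | Torus2 => fun g =>
      Lnorm (mrestr (mu \x mu)%E measurable_square) p
        (fun s => (g (point2 s))%:E)
  end.

Definition LtLx_norm (D : torus) (T : R) (h : R -> 'rV[R]_(torus_dim D) -> R) :
    \bar R :=
  Lnorm (mrestr mu (measurable_segment T)) 2%:E (fun t => Lx_norm 2%:E (h t)).

Definition cylinder_measurable (D : torus) (T : R) :
    (R -> 'rV[R]_(torus_dim D) -> R) -> Prop :=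
  match D with
  | Torus1 => fun h =>
      measurable_fun (`[0, T] `*` `[0, 1] :
                       set (measurableTypeR R * measurableTypeR R))
        (fun p => h p.1 (point1 p.2) : measurableTypeR R)
  | Torus2 => fun h =>
      measurable_fun (`[0, T] `*` (`[0, 1] `*` `[0, 1]) :
                       set (measurableTypeR R *
                            (measurableTypeR R * measurableTypeR R)))
        (fun p => h p.1 (point2 p.2) : measurableTypeR R)
  end.

Definition in_LtLx (D : torus) (T : R)
    (h : R -> 'rV[R]_(torus_dim D) -> R) : Prop :=
  cylinder_measurable T h /\ (LtLx_norm T h < +oo)%E.

Definition torus_inf (n : nat) (g : 'rV[R]_n -> R) : \bar R :=
  ereal_inf (range (fun x => (g x)%:E)).

Definition torus_sup (n : nat) (g : 'rV[R]_n -> R) : \bar R :=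
  ereal_sup (range (fun x => (g x)%:E)).

End norms.

(* Main.v *)
Require Import Defs.
From mathcomp Require Import all_boot all_order all_algebra.
From mathcomp Require Import ring lra.
From mathcomp Require Import all_classical all_reals all_analysis.
From mathcomp Require Import measurable_realfun ess_sup_inf.
Import Order.TTheory GRing.Theory Num.Theory.
Import numFieldNormedType.Exports.

Set Implicit Arguments.
Unset Strict Implicit.
Unset Printing Implicit Defensive.

Local Open Scope classical_set_scope.
Local Open Scope ring_scope.

(** The two solutions are compared by the energy method.  Write ua, ub for
them, w for their difference, |.| for the L^2 norm over the period cell and
k for the L^infinity norm of a - b.  Since w starts from 0 and solves
w_t = div (a grad w) + div ((a - b) grad ub), testing with w and absorbing the
cross term by Young's inequality gives
  d/dt |w|^2 <= k^2 / (2 m) |grad ub|^2,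
while testing the equation of ub with ub gives
  d/dt |ub|^2 <= - 2 m |grad ub|^2 + |ub|^2 + |f|^2.
The gradient of ub, whose size must not enter the constant, is absorbed in
  Phi (t) = |w|^2 + k^2 / (2 m)^2 exp (T - t) |ub|^2,
and what remains is Phi' <= k^2 / (2 m)^2 exp T |f|^2; the factor exp (T - t)
plays the part of Gronwall's lemma.  Integrating over [s, t] and letting s tend
to 0 bounds |w (t)|^2 by k^2 times a quantity that depends on T, m, f and u0
only ([difference_bound]), and integrating once more over [0, T] gives the
theorem ([heat_stability]).

Both tori are handled at once.  All that the argument needs of the cell of
integration is collected in [periodic_cell]: total mass one, measurability of
continuous functions, compactness, and the vanishing of the integral of a
partial derivative of a periodic C^1 function, from which Green's identity
follows.  It is established for [0, 1] and for [0, 1]^2 in [periodic_cell1] and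
[periodic_cell2].

The equation holds at times 0 < t < T only, and the derivatives of the solutions
may blow up at both ends.  The energies are therefore differentiated under the
integral sign inside ]0, T[, and the values at 0 and T are reached by
continuity: freezing time outside [0, T] turns the solution into a function
continuous on all of R x R^n. *)

(** * Nonnegative integrals and restricted measures *)

Section nonnegative_integrals.
Context d (X : measurableType d) (R : realType).
Import HBNNSimple.
Local Open Scope ereal_scope.

(** The integral of a nonnegative function is a supremum over the simple
functions below it, hence is monotone even where measurability fails.  This
matters for the norm of [f] over the cylinder: nothing is known of the
dependence of [f] on time outside [0, T]. *)
Lemma ge0_subset_le_integral (mu : {measure set X -> \bar R})
    (A B : set X) (f g : X -> \bar R) :
  (forall x, A x -> 0 <= f x) -> (forall x, B x -> 0 <= g x) ->
  A `<=` B -> (forall x, A x -> f x <= g x) ->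
  \int[mu]_(x in A) f x <= \int[mu]_(x in B) g x.
Proof.
move=> f0 g0 AB fg; rewrite !ge0_integralE//.
apply: ereal_sup_le => _ [h /= hf <-]; exists h => //= x.
apply: (le_trans (hf x)); rewrite /patch; case: ifPn => [|_].
  by rewrite inE => Ax; rewrite mem_set; [exact: fg|exact: AB].
by case: ifPn => //; rewrite inE => /g0.
Qed.

(** The two integrals agree on simple functions by additivity, and a simple
function below [f] on [D] may be taken to vanish off [D], so that both sides are
suprema of the same family. *)
Lemma ge0_integral_mrestr (mu : {measure set X -> \bar R}) (D : set X)
    (mD : measurable D) (f : X -> \bar R) :
  (forall x, 0 <= f x) ->
  \int[mrestr mu mD]_x f x = \int[mu]_(x in D) f x.
Proof.
move=> f0.
have restr_setI (h : {nnsfun X >-> R}) :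
    \int[mrestr mu mD]_x (h x)%:E = \int[mu]_(x in D) (h x)%:E.
  have mh : measurable_fun [set: X] (EFin \o h).
    exact/measurable_EFinP.
  have h0 x : 0 <= (h x)%:E by rewrite lee_fin fun_ge0.
  have -> : [set: X] = D `|` ~` D by rewrite setUv.
  rewrite ge0_integral_setU//; last 3 first.
  - exact: measurableC.
  - by rewrite setUv.
  - by rewrite /disj_set setICr.
  rewrite (@eq_measure_integral _ _ _ D mu); last first.
    by move=> A mA AD; rewrite /= /mrestr setIidl.
  rewrite [X in _ + X](_ : _ = 0) ?adde0//.
  apply: null_set_integral; [exact: measurableC| |].
  - exact: measurable_funTS.
  - by rewrite /= /mrestr setICl measure0.
apply/eqP; rewrite eq_le; apply/andP; split.
- rewrite ge0_integralTE//; apply: ge_ereal_sup => _ [h /= hf <-].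
  rewrite -integralT_nnsfun restr_setI.
  apply: ge0_subset_le_integral => //= x _.
  by rewrite lee_fin fun_ge0.
- rewrite [leLHS]ge0_integralE//; apply: ge_ereal_sup => _ [h /= hf <-].
  rewrite -integralT_nnsfun.
  rewrite [leLHS](_ : _ = \int[mu]_(x in D) (h x)%:E); last first.
    rewrite [in RHS]integral_mkcond; apply: eq_integral => x _.
    rewrite patchE; case: ifPn => // xD; apply/eqP; rewrite eq_le.
    have := hf x; rewrite patchE (negbTE xD) => -> /=.
    by rewrite lee_fin fun_ge0.
  rewrite -restr_setI; apply: ge0_subset_le_integral => //= x _.
    by rewrite lee_fin fun_ge0.
  by apply: (le_trans (hf x)); rewrite patchE; case: ifPn.
Qed.

Lemma ae_le_Rintegral (mu : {measure set X -> \bar R}) (D : set X)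
    (f g : X -> R) : measurable D ->
  mu.-integrable D (EFin \o f) -> mu.-integrable D (EFin \o g) ->
  {ae mu, forall x, D x -> (f x <= g x)%R} ->
  (\int[mu]_(x in D) f x <= \int[mu]_(x in D) g x)%R.
Proof.
move=> mD intf intg [N [mN N0 DN]].
rewrite /Rintegral (negligible_integral mN mD intf N0).
rewrite (negligible_integral mN mD intg N0).
apply: le_Rintegral.
- exact: measurableD.
- by apply: (integrableS mD) => //; exact: measurableD.
- by apply: (integrableS mD) => //; exact: measurableD.
- move=> x [Dx Nx]; apply: contrapT => fg; apply: Nx; apply: DN => /=.
  by move/(_ Dx).
Qed.

Lemma Lnorm2_sqr (mu : {measure set X -> \bar R}) (D : set X)
    (mD : measurable D) (f : X -> \bar R) :
  Lnorm (mrestr mu mD) 2%:E f ^+ 2 = \int[mu]_(x in D) (f x ^+ 2).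
Proof.
have sqrE (y : \bar R) : (`|y| `^ 2)%E = y ^+ 2.
  case: y => [r| |] /=.
  - by rewrite powR_mulrn ?normr_ge0// real_normK ?num_real// EFin_expe.
  - by rewrite pnatr_eq0 mulyy.
  - by rewrite pnatr_eq0 mulNyNy.
rewrite -ge0_integral_mrestr; last first.
  by move=> x; rewrite -sqrE poweR_ge0.
under [RHS]eq_integral do rewrite -sqrE.
rewrite -poweR_Lnorm ?pnatr_eq0// -sqrE gee0_abs//; exact: Lnorm_ge0.
Qed.

End nonnegative_integrals.

(** * Continuity and measurability over the line and the plane *)

Section real_topology.
Context {R : realType}.

Lemma continuous_le_itvcc (psi : R -> R) (a b c : R) : a < b ->
  continuous psi -> (forall s, a < s < b -> psi s <= c) ->
  forall s, a <= s <= b -> psi s <= c.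
Proof.
move=> ab cpsi psic s /andP[as_ sb].
rewrite leNgt; apply/negP => cs.
have /nbhs_ballP[e /= e0 he] : \forall y \near s, c < psi y.
  exact: (cvgr_gt _ (cpsi s)).
have [y yab ys] : exists2 y, a < y < b & `|s - y| < e.
  have [sm|sm] := leP s ((a + b) / 2).
  - exists (s + Num.min (e / 2) ((b - a) / 4)).
      by case: (leP (e / 2) ((b - a) / 4)) => ?; apply/andP; split; lra.
    rewrite opprD addNKr normrN gtr0_norm; last by rewrite lt_min; lra.
    by rewrite gt_min; lra.
  - exists (s - Num.min (e / 2) ((b - a) / 4)).
      by case: (leP (e / 2) ((b - a) / 4)) => ?; apply/andP; split; lra.
    rewrite opprB addrC subrK gtr0_norm; last by rewrite lt_min; lra.
    by rewrite gt_min; lra.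
by have := he y ys; rewrite /= ltNge psic.
Qed.

Lemma strip_bounded n (K : set 'rV[R]_n) (h : R -> 'rV[R]_n -> R) (s t : R) :
  compact K ->
  (forall p : R * 'rV[R]_n, s <= p.1 <= t ->
    {for p, continuous (fun q : R * 'rV[R]_n => h q.1 q.2)}) ->
  exists2 C, 0 <= C & forall r x, s <= r <= t -> K x -> `|h r x| <= C.
Proof.
move=> cK ch.
have cSK : compact (`[s, t]%classic `*` K).
  by apply: compact_setX => //; exact: segment_compact.
have /compact_bounded[C [_ hC]] :
    compact ((fun q : R * 'rV[R]_n => h q.1 q.2) @` (`[s, t]%classic `*` K)).
  apply: continuous_compact => //; apply: continuous_in_subspaceT => p.
  by rewrite inE => -[/=]; rewrite in_itv/= => p1 _; exact: ch.
exists (`|C| + 1); first by rewrite addr_ge0.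
move=> r x rst Kx; apply: (hC (`|C| + 1)) => /=.
  by rewrite (le_lt_trans (ler_norm C))// ltrDl.
by exists (r, x) => //=; split => //; rewrite /= in_itv.
Qed.

(** Freezing time outside [0, T] extends a function given on the closed cylinder
continuously to all times, so that integrals over the cell are continuous in
time up to 0 and T. *)
Definition clamp (T t : R) : R := Num.min T (Num.max 0 t).

Lemma clamp_itv (T t : R) : 0 <= T -> 0 <= clamp T t <= T.
Proof. by move=> T0; rewrite /clamp le_min ge_min lexx le_max lexx T0. Qed.

Lemma clamp_id (T t : R) : 0 <= t <= T -> clamp T t = t.
Proof. by case/andP => t0 tT; rewrite /clamp max_r// min_r. Qed.

Lemma continuous_clamp (T : R) : continuous (clamp T).
Proof.
move=> t; apply: (@continuous_min R R (cst T) (fun t => Num.max 0 t)).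
  exact: cst_continuous.
by apply: (@continuous_max R R (cst 0) id) => //; exact: cst_continuous.
Qed.

Lemma clamped_continuous n (T : R) (h : R -> 'rV[R]_n -> R) : 0 <= T ->
  {within [set p : R * 'rV[R]_n | 0 <= p.1 <= T],
    continuous (fun p : R * 'rV[R]_n => h p.1 p.2)} ->
  continuous (fun p : R * 'rV[R]_n => h (clamp T p.1) p.2).
Proof.
move=> T0 /subspace_continuousP ch p.
pose g (q : R * 'rV[R]_n) := (clamp T q.1, q.2).
have gT q : 0 <= (g q).1 <= T by exact: clamp_itv.
have cg : g q @[q --> p] --> g p.
  apply: (@cvg_pair _ _ _ (nbhs p) (nbhs (clamp T p.1)) (nbhs p.2)
    _ _ _ (fun q => clamp T q.1) snd); last exact: cvg_snd.
  apply: (@cvg_comp _ _ _ fst (clamp T) _ (nbhs p.1)); first exact: cvg_fst.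
  exact: continuous_clamp.
move=> U hU; have /cg gU := ch (g p) (gT p) U hU.
apply: (@filterS _ (nbhs p) _ _ _ _ gU) => q.
by apply; exact: gT.
Qed.

(** An open subset of the plane is the union of the countably many boxes with
rational centre and radius that it contains. *)
Lemma open_measurable_prod (U : set (R * R)) : open U ->
  measurable (U : set (measurableTypeR R * measurableTypeR R)).
Proof.
move=> oU.
pose box (q : rat * rat * rat) : set (R * R) :=
  ball (ratr q.1.1 : R) (ratr q.2 : R) `*` ball (ratr q.1.2 : R) (ratr q.2 : R).
have -> : U = \bigcup_(q in [set q | box q `<=` U]) box q.
  apply/seteqP; split => [[x y] Uxy|]; last by move=> p [q]; apply.
  have /nbhs_ballP[e /= e0 he] : nbhs (x, y) U by exact: open_nbhs_nbhs.
  (* centre within e/4 of the point, radius between e/4 and e/2 *)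
  have e2 : e / 4 < e / 2 by lra.
  have [d] := rat_in_itvoo e2; rewrite in_itv/= => /andP[ed de].
  have xx : x - e / 4 < x + e / 4 by lra.
  have [a] := rat_in_itvoo xx; rewrite in_itv/= => /andP[xa ax].
  have yy : y - e / 4 < y + e / 4 by lra.
  have [b] := rat_in_itvoo yy; rewrite in_itv/= => /andP[yb by_].
  exists (a, b, d).
    move=> [z w] [/=]; rewrite /ball/= !ltr_norml => /andP[? ?] /andP[? ?].
    apply: he; split => /=; rewrite /ball/= ltr_norml; apply/andP; split; lra.
  by split => /=; rewrite /ball/= ltr_norml; apply/andP; split; lra.
rewrite bigcup_mkcond; apply: countable_bigcupT_measurable => // q.
by case: ifPn => // _; apply: measurableX; exact: measurable_ball.
Qed.

Lemma continuous_measurable_fun_prod (g : R * R -> R) : continuous g ->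
  measurable_fun setT
    (g : measurableTypeR R * measurableTypeR R -> measurableTypeR R).
Proof.
move=> cg; apply: (measurability _ (RGenOInfty.measurableE R)) => //.
move=> _ [_ [x ->] <-]; rewrite setTI; apply: open_measurable_prod.
by move/continuousP : cg; apply; exact: interval_open.
Qed.

End real_topology.

(** * The period cells of the one- and two-dimensional torus *)

Section lines.
Context {R : realType} {n : nat}.
Implicit Types (i : 'I_n) (g : 'rV[R]_n -> R) (x q : 'rV[R]_n).

Lemma periodic_partial i g :
  torus_periodic g -> torus_periodic (partial i g).
Proof.
move=> pg x j; rewrite /partial /derive.
rewrite [X in lim (X @ _)](_ : _ = fun h : R => h^-1 *:
  ((g \o shift x) (h *: delta_mx 0 i) - g x))//.
by apply/funext => h /=; rewrite pg addrA pg.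
Qed.

Definition line i q (y : R) : 'rV[R]_n := y *: delta_mx 0 i + q.

Lemma continuous_line i q : continuous (line i q).
Proof.
move=> y; rewrite /line.
apply: (@cvgD R 'rV[R]_n _ _ _ (fun y => y *: delta_mx 0 i) (cst q)).
  by apply: cvgZr_tmp; exact: cvg_id.
exact: cvg_cst.
Qed.

(** Along a coordinate line the difference quotients of [g] are literally those
that define its partial derivative. *)
Lemma line_quotientE i q g (y : R) :
  (fun h : R => h^-1 *: (((g \o line i q) \o shift y) (h *: 1) - g (line i q y)))
  = (fun h : R => h^-1 *: ((g \o shift (line i q y)) (h *: delta_mx 0 i)
                           - g (line i q y))).
Proof.
apply/funext => h /=; congr (_ *: (g _ - _)).
by rewrite /line scaler1 scalerDl addrA.
Qed.

Lemma derivable_line i q g (y : R) :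
  has_partial i g (line i q y) -> derivable (g \o line i q) y 1.
Proof. by rewrite /has_partial /derivable line_quotientE. Qed.

Lemma derive1_line i q g (y : R) :
  derive1 (g \o line i q) y = partial i g (line i q y).
Proof. by rewrite derive1E /derive line_quotientE. Qed.

Record C1_torus g : Prop := C1Torus {
  C1_periodic : torus_periodic g;
  C1_continuous : continuous g;
  C1_derivable : forall i x, has_partial i g x;
  C1_partial : forall i, continuous (partial i g) }.

(** The fundamental theorem of calculus over one period: the two end points
differ by a period, so the boundary terms cancel. *)
Lemma integral_partial_line i q g : C1_torus g ->
  (\int[lebesgue_measure]_(y in `[0%R, 1%R]) (partial i g (line i q y))%:E = 0)%E.
Proof.
move=> [pg cg dg cdg].
have cgl : continuous (g \o line i q).
  by move=> y; apply: continuous_comp; [exact: continuous_line|exact: cg].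
rewrite (@continuous_FTC2 R (partial i g \o line i q) (g \o line i q)) //.
- rewrite -EFinB; congr (_%:E); rewrite /= /line scale1r scale0r add0r.
  by rewrite [delta_mx _ _ + q]addrC pg subrr.
- apply: continuous_subspaceT => y.
  apply: continuous_comp; [exact: continuous_line|exact: cdg].
- split.
  + by move=> y _; apply: derivable_line; exact: dg.
  + by apply: cvg_at_right_filter; exact: cgl.
  + by apply: cvg_at_left_filter; exact: cgl.
- by move=> y _; rewrite derive1_line.
Qed.

End lines.

Arguments C1_periodic {R n g} _.
Arguments C1_continuous {R n g} _.
Arguments C1_derivable {R n g} _.
Arguments C1_partial {R n g} _.

(** A fundamental domain [B], carrying the measure [mu] and mapped to the space
by [pt], over which the energy method works.  The last field is the divergence
theorem on the torus, from which integration by parts without boundary terms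
follows. *)
Record periodic_cell d (X : measurableType d) (R : realType) (n : nat)
    (mu : {measure set X -> \bar R}) (B : set X) (pt : X -> 'rV[R]_n) : Prop :=
  PeriodicCell {
  cell_measurable : measurable B;
  cell_mass : mu B = 1%E;
  cell_measurable_fun : forall g : 'rV[R]_n -> R, continuous g ->
    measurable_fun B (g \o pt);
  cell_compact : exists2 K : set 'rV[R]_n, compact K & forall s, B s -> K (pt s);
  cell_divergence : forall (i : 'I_n) (g : 'rV[R]_n -> R),
    C1_torus g -> \int[mu]_(s in B) partial i g (pt s) = 0 }.

Section cell_integral.
Context d (X : measurableType d) (R : realType) (n : nat)
  (mu : {measure set X -> \bar R}) (B : set X) (pt : X -> 'rV[R]_n).

Lemma integrable_on_cell (g : 'rV[R]_n -> R) :
  measurable B -> (mu B < +oo)%E -> measurable_fun B (g \o pt) ->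
  (exists2 K : set 'rV[R]_n, compact K & forall s, B s -> K (pt s)) ->
  continuous g -> mu.-integrable B (fun s => (g (pt s))%:E).
Proof.
move=> mB Boo mg [K cK BK] cg.
apply: (@measurable_bounded_integrable _ _ _ mu (g \o pt)) => //.
have /compact_bounded[C [Creal hC]] : compact (g @` K).
  by apply: continuous_compact => //; exact: continuous_subspaceT.
exists C; split => // M CM s Bs /=; apply: (hC _ CM) => /=.
by exists (pt s) => //; exact: BK.
Qed.

End cell_integral.

Section cells.
Context {R : realType}.
Local Notation mu := (@lebesgue_measure R).

Lemma point1E : @point1 R = line 0 0.
Proof.
apply/funext => s; apply/rowP => i; rewrite /line !mxE addr0 ord1 eqxx/=.
by rewrite mulr1.
Qed.

Lemma point2E0 (y : R) : (fun x => point2 (x, y)) = line 0 (y *: delta_mx 0 1).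
Proof.
apply/funext => x; apply/rowP => i; rewrite /line !mxE /=.
have [->|i0] := eqVneq i 0; first by rewrite !mulr0 mulr1 ?addr0.
have -> : i = 1 by case: i i0 => -[|[|//]] // ? _; exact/val_inj.
by rewrite eqxx /= mulr0 mulr1 add0r.
Qed.

Lemma point2E1 (x : R) : (fun y => point2 (x, y)) = line 1 (x *: delta_mx 0 0).
Proof.
apply/funext => y; rewrite -[LHS]/((fun x => point2 (x, y)) x) point2E0.
by rewrite /line addrC.
Qed.

Lemma continuous_point2 : continuous (@point2 R).
Proof.
have -> : @point2 R = fun p => p.1 *: delta_mx 0 0 + p.2 *: delta_mx 0 1.
  by apply/funext => -[x y]; rewrite -[LHS]/((fun x => point2 (x, y)) x) point2E0.
move=> p; apply: (@cvgD R 'rV[R]_2 _ _ _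
  (fun p : R * R => p.1 *: delta_mx 0 0) (fun p => p.2 *: delta_mx 0 1)).
- by apply: cvgZr_tmp; exact: cvg_fst.
- by apply: cvgZr_tmp; exact: cvg_snd.
Qed.

Lemma lebesgue_unit_interval : mu `[0%R, 1%R]%classic = 1%E.
Proof. by rewrite lebesgue_measure_itv/= lte_fin ltr01 oppr0 adde0. Qed.

Lemma periodic_cell1 : periodic_cell mu `[0%R, 1%R]%classic (@point1 R).
Proof.
split.
- exact: measurable_itv.
- exact: lebesgue_unit_interval.
- move=> g cg; apply: measurable_funTS; apply: continuous_measurable_fun => s.
  rewrite point1E; apply: continuous_comp; first exact: continuous_line.
  exact: cg.
- exists (@point1 R @` `[0%R, 1%R]%classic); last by move=> s Bs; exists s.
  apply: continuous_compact; last exact: segment_compact.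
  by rewrite point1E; apply: continuous_subspaceT; exact: continuous_line.
- move=> i g C1g; rewrite point1E.
  rewrite (ord1 i) /Rintegral.
  by have -> := integral_partial_line 0 0 C1g.
Qed.

(** For a partial derivative, Fubini's theorem allows to integrate first in the
direction of differentiation, where [integral_partial_line] gives 0. *)
Lemma periodic_cell2 : periodic_cell (mu \x mu)%E
  (`[0%R, 1%R] `*` `[0%R, 1%R] : set (measurableTypeR R * measurableTypeR R))
  (@point2 R).
Proof.
have mB := @measurable_square R.
have B1 : (mu \x mu)%E
  (`[0%R, 1%R] `*` `[0%R, 1%R] : set (measurableTypeR R * measurableTypeR R))
  = 1%E.
  rewrite product_measure1E ?measurable_itv//.
  by rewrite -[RHS]mule1; congr (_ * _)%E; exact: lebesgue_unit_interval.
have mf (g : 'rV[R]_2 -> R) : continuous g ->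
    measurable_fun (`[0%R, 1%R] `*` `[0%R, 1%R] :
      set (measurableTypeR R * measurableTypeR R)) (g \o @point2 R).
  move=> cg; apply: measurable_funTS; apply: continuous_measurable_fun_prod => s.
  apply: continuous_comp; first exact: continuous_point2.
  exact: cg.
have cB : exists2 K : set 'rV[R]_2, compact K & forall s : R * R,
    (`[0%R, 1%R] `*` `[0%R, 1%R]) s -> K (point2 s).
  exists (@point2 R @` (`[0%R, 1%R] `*` `[0%R, 1%R]))%classic.
    apply: continuous_compact.
      by apply: continuous_subspaceT; exact: continuous_point2.
    by apply: compact_setX; exact: segment_compact.
  by move=> s Bs; exists s.
split => // i g C1g; rewrite /Rintegral; have cdg := C1_partial C1g i.
set B := (X in integral _ X _) in mB *.
have int_g : (mu \x mu)%E.-integrable B (fun s => (partial i g (point2 s))%:E).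
  apply: (integrable_on_cell mB _ (mf _ cdg) cB cdg).
  by have := ltry (1 : R); rewrite -[X in (X < _)%E -> _]B1.
rewrite integral_mkcond.
pose f := (fun s : measurableTypeR R * measurableTypeR R =>
  (partial i g (point2 s))%:E) \_ B.
have int_f : (mu \x mu)%E.-integrable setT f by apply/(integrable_mkcond _ mB).
rewrite -[X in fine (integral _ _ X)]/f.
have [i0|i1] : i = 0 \/ i = 1.
  by case: i {cdg int_g f int_f} => -[|[|//]] ?;
    [left|right]; exact/val_inj.
- rewrite -integral21_prod_meas1//= integral0_eq// => y _.
  rewrite /fubini_G.
  have [y01|y01] := pselect (`[0%R, 1%R]%classic y); last first.
    by apply: integral0_eq => x _; rewrite /f /patch memNset// => -[].
  transitivity (\int[mu]_x
      ((fun x => (partial i g (point2 (x, y)))%:E) \_ `[0%R, 1%R]) x)%E.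
    apply: eq_integral => x _; rewrite /f /patch; congr (if _ then _ else _).
    by apply/idP/idP; rewrite !inE => //= -[].
  rewrite -integral_mkcond -[RHS](integral_partial_line i (y *: delta_mx 0 1) C1g).
  by apply: eq_integral => x _; rewrite i0 -point2E0.
- rewrite -integral12_prod_meas1//= integral0_eq// => x _.
  rewrite /fubini_F.
  have [x01|x01] := pselect (`[0%R, 1%R]%classic x); last first.
    by apply: integral0_eq => y _; rewrite /f /patch memNset// => -[].
  transitivity (\int[mu]_y
      ((fun y => (partial i g (point2 (x, y)))%:E) \_ `[0%R, 1%R]) y)%E.
    apply: eq_integral => y _; rewrite /f /patch; congr (if _ then _ else _).
    by apply/idP/idP; rewrite !inE => //= -[].
  rewrite -integral_mkcond -[RHS](integral_partial_line i (x *: delta_mx 0 0) C1g).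
  by apply: eq_integral => y _; rewrite i1 -point2E1.
Qed.

End cells.

(** * Calculus of integrals over a period cell *)

Lemma cvg_sumr {R : realType} {T : Type} {F : set_system T} {FF : Filter F}
    (I : Type) (r : seq I) (f : I -> T -> R) (l : I -> R) :
  (forall i, f i x @[x --> F] --> l i) ->
  \sum_(i <- r) f i x @[x --> F] --> \sum_(i <- r) l i.
Proof. by move=> fl; apply: cvg_big => //; exact: add_continuous. Qed.

Lemma continuous_at_cstM {R : realType} {T : topologicalType} (c : R)
    (f : T -> R) x :
  {for x, continuous f} -> {for x, continuous (fun x => c * f x)}.
Proof.
move=> cf; apply: (@cvgM _ _ (nbhs x) _ (fun=> c) f _ _ _ cf).
exact: cvg_cst.
Qed.

Lemma continuous_cstM {R : realType} {T : topologicalType} (c : R) (f : T -> R) :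
  continuous f -> continuous (fun x => c * f x).
Proof. by move=> cf x; exact: (continuous_at_cstM (cf x)). Qed.

Section strips.
Context {R : realType} {n : nat} (u v : R).
Implicit Types (h k : R -> 'rV[R]_n -> R) (g : 'rV[R]_n -> R).

Definition continuous_strip h : Prop := forall p : R * 'rV[R]_n, u < p.1 < v ->
  {for p, continuous (fun q : R * 'rV[R]_n => h q.1 q.2)}.

Lemma strip_cst g : continuous g -> continuous_strip (fun _ => g).
Proof.
move=> cg p _; apply: (@continuous_comp _ _ _ snd g); first exact: cvg_snd.
exact: cg.
Qed.

Lemma stripD h k : continuous_strip h -> continuous_strip k ->
  continuous_strip (fun t x => h t x + k t x).
Proof. by move=> ch ck p hp; apply: cvgD; [exact: ch|exact: ck]. Qed.

Lemma stripB h k : continuous_strip h -> continuous_strip k ->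
  continuous_strip (fun t x => h t x - k t x).
Proof. by move=> ch ck p hp; apply: cvgB; [exact: ch|exact: ck]. Qed.

Lemma stripM h k : continuous_strip h -> continuous_strip k ->
  continuous_strip (fun t x => h t x * k t x).
Proof. by move=> ch ck p hp; apply: cvgM; [exact: ch|exact: ck]. Qed.

Lemma strip_sum (h : 'I_n -> R -> 'rV[R]_n -> R) :
  (forall i, continuous_strip (h i)) ->
  continuous_strip (fun t x => \sum_i h i t x).
Proof.
by move=> ch p hp; apply: cvg_sumr => i; exact: ch.
Qed.

Lemma strip_slice h t : continuous_strip h -> u < t < v -> continuous (h t).
Proof.
move=> ch utv x.
apply: (@continuous_comp _ _ _ (fun y => (t, y)) (fun q => h q.1 q.2)).
  apply: (@cvg_pair _ _ _ (nbhs x) (nbhs t) (nbhs x) _ _ _ (fun=> t) id).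
    exact: cvg_cst.
  exact: cvg_id.
exact: ch.
Qed.

Lemma strip_time h t x : continuous_strip h -> u < t < v ->
  {for t, continuous (h^~ x)}.
Proof.
move=> ch utv.
apply: (@continuous_comp _ _ _ (fun s => (s, x)) (fun q => h q.1 q.2)).
  apply: (@cvg_pair _ _ _ (nbhs t) (nbhs t) (nbhs x) _ _ _ id (fun=> x)).
    exact: cvg_id.
  exact: cvg_cst.
exact: ch.
Qed.

End strips.

Section strip_criteria.
Context {R : realType} {n : nat} (u v : R).

Lemma strip_eq (h k : R -> 'rV[R]_n -> R) :
  (forall t x, u < t < v -> h t x = k t x) ->
  continuous_strip u v h -> continuous_strip u v k.
Proof.
move=> hk ch p uv.
suff : k q.1 q.2 @[q --> p] --> h p.1 p.2 by rewrite hk.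
apply: cvg_trans (ch p uv); apply: near_eq_cvg.
have near_uv : \forall t \near p.1, t \in `]u, v[ by apply: near_in_itvoo.
have : \forall q \near p, q.1 \in `]u, v[.
  exact: (@cvg_fst _ _ (nbhs p.1) (nbhs p.2) _ _ near_uv).
by apply: filterS => q; rewrite in_itv/= => quv; rewrite hk.
Qed.

Lemma strip_within (h : R -> 'rV[R]_n -> R) :
  {within [set p : R * 'rV[R]_n | u <= p.1 <= v],
    continuous (fun p : R * 'rV[R]_n => h p.1 p.2)} ->
  continuous_strip u v h.
Proof.
move=> /subspace_continuousP ch p /andP[up pv].
have pA : u <= p.1 <= v by rewrite !ltW.
move=> U hU; have := ch p pA U hU.
have near_uv : \forall t \near p.1, t \in `]u, v[.
  by apply: near_in_itvoo; rewrite in_itv/= up.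
have : \forall q \near p, q.1 \in `]u, v[.
  exact: (@cvg_fst _ _ (nbhs p.1) (nbhs p.2) _ _ near_uv).
apply: filterS2 => q; rewrite in_itv/= => /andP[uq qv].
by apply; rewrite /= !ltW.
Qed.

End strip_criteria.

Section C1_torus_algebra.
Context {R : realType} {n : nat}.
Implicit Types (g : 'rV[R]_n -> R) (i : 'I_n).

Lemma partialM i g1 g2 x : has_partial i g1 x -> has_partial i g2 x ->
  partial i (fun y => g1 y * g2 y) x =
  g1 x * partial i g2 x + partial i g1 x * g2 x.
Proof.
move=> d1 d2; rewrite /partial (deriveM d1 d2).
by rewrite /GRing.scale/= [g2 x * _]mulrC.
Qed.

Lemma partialB i g1 g2 x : has_partial i g1 x -> has_partial i g2 x ->
  partial i (fun y => g1 y - g2 y) x = partial i g1 x - partial i g2 x.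
Proof. by move=> d1 d2; rewrite /partial (deriveB d1 d2). Qed.

Lemma C1_torusM g1 g2 : C1_torus g1 -> C1_torus g2 ->
  C1_torus (fun x => g1 x * g2 x).
Proof.
move=> [p1 c1 d1 cd1] [p2 c2 d2 cd2]; split.
- by move=> x i; rewrite p1 p2.
- by move=> x; exact: (cvgM (c1 x) (c2 x)).
- by move=> i x; exact: (derivableM (d1 i x) (d2 i x)).
- move=> i; rewrite (_ : partial i _ =
      fun x => g1 x * partial i g2 x + partial i g1 x * g2 x).
    by move=> x; exact: (cvgD (cvgM (c1 x) (cd2 i x)) (cvgM (cd1 i x) (c2 x))).
  by apply/funext => x; rewrite partialM.
Qed.

Lemma C1_torusB g1 g2 : C1_torus g1 -> C1_torus g2 ->
  C1_torus (fun x => g1 x - g2 x).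
Proof.
move=> [p1 c1 d1 cd1] [p2 c2 d2 cd2]; split.
- by move=> x i; rewrite p1 p2.
- by move=> x; exact: (cvgB (c1 x) (c2 x)).
- by move=> i x; exact: (derivableB (d1 i x) (d2 i x)).
- move=> i; rewrite (_ : partial i _ = fun x => partial i g1 x - partial i g2 x).
    by move=> x; exact: (cvgB (cd1 i x) (cd2 i x)).
  by apply/funext => x; rewrite partialB.
Qed.

Lemma smooth_C1_torus g : smooth_torus g -> C1_torus g.
Proof.
move=> [pg sg]; split => //.
- by have [] := sg [::].
- by move=> i x; have [_] := sg [::]; exact.
- by move=> i; have [] := sg [:: i].
Qed.

End C1_torus_algebra.

Section cell_calculus.
Context d (X : measurableType d) (R : realType) (n : nat)
  (mu : {measure set X -> \bar R}) (B : set X) (pt : X -> 'rV[R]_n).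
Context (cell : periodic_cell mu B pt).
Implicit Types (g : 'rV[R]_n -> R) (h : R -> 'rV[R]_n -> R).

Definition cell_integral g : R := \int[mu]_(s in B) g (pt s).

Lemma cell_integrable g : continuous g ->
  mu.-integrable B (EFin \o (g \o pt)).
Proof.
move=> cg; apply: integrable_on_cell => //.
- exact: cell_measurable cell.
- by rewrite (cell_mass cell) ltry.
- exact: (cell_measurable_fun cell cg).
- exact: cell_compact cell.
Qed.

Lemma cell_integrable_cst (c : R) : mu.-integrable B (fun=> c%:E).
Proof. exact: (@cell_integrable (fun=> c) (@cst_continuous _ _ c)). Qed.

Lemma cell_integralD g1 g2 : continuous g1 -> continuous g2 ->
  cell_integral (fun x => g1 x + g2 x) = cell_integral g1 + cell_integral g2.
Proof.
move=> c1 c2; apply: (@RintegralD _ _ _ mu B (g1 \o pt) (g2 \o pt)).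
- exact: cell_measurable cell.
- exact: cell_integrable.
- exact: cell_integrable.
Qed.

Lemma cell_integralZ (c : R) g : continuous g ->
  cell_integral (fun x => c * g x) = c * cell_integral g.
Proof.
move=> cg; apply: (@RintegralZl _ _ _ mu B (g \o pt)).
- exact: cell_measurable cell.
- exact: cell_integrable.
Qed.

Lemma cell_integral_sum (g : 'I_n -> 'rV[R]_n -> R) :
  (forall i, continuous (g i)) ->
  cell_integral (fun x => \sum_i g i x) = \sum_i cell_integral (g i).
Proof.
move=> cg; have csum (s : seq 'I_n) : continuous (fun x => \sum_(i <- s) g i x).
  by move=> x; apply: (@cvg_sumr R _ (nbhs x)) => i; exact: cg.
elim: (index_enum _) => [|i s IHs].
  rewrite big_nil -[RHS](mul0r (cell_integral (fun=> 0))).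
  rewrite -cell_integralZ; last exact: cst_continuous.
  by congr cell_integral; apply/funext => x; rewrite big_nil mul0r.
rewrite big_cons -IHs -cell_integralD//.
by congr cell_integral; apply/funext => x; rewrite big_cons.
Qed.

Lemma cell_integral_ge0 g : (forall x, 0 <= g x) -> 0 <= cell_integral g.
Proof. by move=> g0; apply: Rintegral_ge0. Qed.

Lemma le_cell_integral g1 g2 : continuous g1 -> continuous g2 ->
  {ae mu, forall s, B s -> g1 (pt s) <= g2 (pt s)} ->
  cell_integral g1 <= cell_integral g2.
Proof.
move=> c1 c2; apply: ae_le_Rintegral.
- exact: cell_measurable cell.
- exact: cell_integrable.
- exact: cell_integrable.
Qed.

(** Continuity is local: on a closed subinterval of ]u, v[ the integrand is
bounded over the cell by compactness, so a constant dominates it. *)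
Lemma cell_integral_continuous (u v : R) h : continuous_strip u v h ->
  forall t, u < t < v -> {for t, continuous (fun t => cell_integral (h t))}.
Proof.
move=> ch t /andP[ut tv].
have [K cK BK] := cell_compact cell.
have [C C0 hC] : exists2 C, 0 <= C &
    forall r x, (u + t) / 2 <= r <= (t + v) / 2 -> K x -> `|h r x| <= C.
  apply: strip_bounded => // p /andP[p1 p2]; apply: ch.
  by apply/andP; split; lra.
apply: (@continuity_under_integral R _ X mu (fun t s => h t (pt s)) B
  (cell_measurable cell) ((u + t) / 2) ((t + v) / 2) _ _ (fun=> C)).
- move=> r; rewrite /= in_itv/= => /andP[r1 r2]; apply: cell_integrable.
  by apply: (strip_slice ch); apply/andP; split; lra.
- apply: aeW => s Bs r; rewrite inE/= in_itv/= => /andP[r1 r2].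
  have urv : u < r < v by apply/andP; split; lra.
  exact: (strip_time ch urv).
- exact: cell_integrable_cst.
- move=> r; rewrite /= in_itv/= => /andP[r1 r2]; apply: aeW => s Bs.
  by apply: hC; [apply/andP; split; lra|exact: BK].
- by rewrite inE/= in_itv/=; apply/andP; split; lra.
Qed.

Lemma cell_integral_derive (u v : R) h : continuous_strip u v h ->
  (forall t x, u < t < v -> derivable (h^~ x) t 1) ->
  continuous_strip u v (fun t x => derive1 (h^~ x) t) ->
  forall t, u < t < v ->
    is_derive t 1 (fun t => cell_integral (h t))
      (cell_integral (fun x => derive1 (h^~ x) t)).
Proof.
move=> ch dh cdh t /andP[ut tv].
have [K cK BK] := cell_compact cell.
have [C C0 hC] : exists2 C, 0 <= C &
    forall r x, (u + t) / 2 <= r <= (t + v) / 2 -> K x ->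
      `|derive1 (h^~ x) r| <= C.
  apply: (@strip_bounded R n K (fun t x => derive1 (h^~ x) t)) => //.
  by move=> p /andP[p1 p2]; apply: cdh; apply/andP; split; lra.
have It : `](u + t) / 2, (t + v) / 2[%classic t.
  by rewrite /= in_itv/=; apply/andP; split; lra.
have inth r : `](u + t) / 2, (t + v) / 2[%classic r ->
    mu.-integrable B (EFin \o (h r \o pt)).
  rewrite /= in_itv/= => /andP[r1 r2]; apply: cell_integrable.
  by apply: (strip_slice ch); apply/andP; split; lra.
have derh r s : `](u + t) / 2, (t + v) / 2[%classic r -> B s ->
    derivable (fun r => h r (pt s)) r 1.
  rewrite /= in_itv/= => /andP[r1 r2] _.
  by apply: dh; apply/andP; split; lra.
have bndh r s : `](u + t) / 2, (t + v) / 2[%classic r -> B s ->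
    `|partial1of2 (fun t s => h t (pt s)) r s| <= C.
  rewrite /= in_itv/= => /andP[r1 r2] Bs.
  by apply: hC; [apply/andP; split; lra|exact: BK].
have mB := cell_measurable cell.
apply: DeriveDef.
- exact: (derivable_under_integral mB It inth derh (fun=> C0)
    (cell_integrable_cst C) bndh).
- rewrite -derive1E.
  exact: (differentiation_under_integral mB It inth derh (fun=> C0)
    (cell_integrable_cst C) bndh).
Qed.

(** The integral over the cell of the partial derivative of the product
vanishes. *)
Lemma integration_by_parts_cell i g1 g2 : C1_torus g1 -> C1_torus g2 ->
  cell_integral (fun x => g1 x * partial i g2 x) =
  - cell_integral (fun x => partial i g1 x * g2 x).
Proof.
move=> C1 C2.
have cM1 : continuous (fun x => g1 x * partial i g2 x).
  by move=> x; exact: (cvgM (C1_continuous C1 x) (C1_partial C2 i x)).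
have cM2 : continuous (fun x => partial i g1 x * g2 x).
  by move=> x; exact: (cvgM (C1_partial C1 i x) (C1_continuous C2 x)).
apply/eqP; rewrite -subr_eq0 opprK -cell_integralD//; apply/eqP.
rewrite -[RHS](cell_divergence cell i (C1_torusM C1 C2)).
by apply: eq_Rintegral => s _; rewrite partialM//; exact: C1_derivable.
Qed.

End cell_calculus.

(** * Energy inequalities *)

Section heat_regularity.
Context {R : realType} {n : nat} (T : R) (a : 'rV[R]_n -> R)
  (f : R -> 'rV[R]_n -> R) (u0 : 'rV[R]_n -> R) (u : R -> 'rV[R]_n -> R).
Context (smooth_a : smooth_torus a) (sol : heat_solution T a f u0 u).

Lemma heat_strip : continuous_strip 0 T u.
Proof. by apply: strip_within; exact: (heat_continuous sol). Qed.

Lemma heat_strip_t : continuous_strip 0 T (fun t x => derive1 (u^~ x) t).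
Proof. exact: (heat_continuous_t sol). Qed.

Lemma heat_strip_x i : continuous_strip 0 T (fun t => partial i (u t)).
Proof. exact: (heat_continuous_x sol). Qed.

Lemma heat_strip_xx i j :
  continuous_strip 0 T (fun t => partial j (partial i (u t))).
Proof. exact: (heat_continuous_xx sol). Qed.

Lemma heat_C1 t : 0 < t < T -> C1_torus (u t).
Proof.
move=> tT; have /andP[t0 tT'] := tT; split.
- by apply: (heat_periodic sol); rewrite !ltW.
- exact: strip_slice heat_strip tT.
- by move=> i x; exact: (heat_derivable_x sol).
- by move=> i; exact: (strip_slice (@heat_strip_x i) tT).
Qed.

Lemma heat_partial_C1 t i : 0 < t < T -> C1_torus (partial i (u t)).
Proof.
move=> tT; split.
- by apply: periodic_partial; exact: (C1_periodic (heat_C1 tT)).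
- exact: (C1_partial (heat_C1 tT)).
- by move=> j x; exact: (heat_derivable_xx sol).
- by move=> j; exact: (strip_slice (@heat_strip_xx i j) tT).
Qed.

Definition heat_flux_divergence (t : R) (x : 'rV[R]_n) : R :=
  divergence (fun y => a y *: gradient (u t) y) x.

Lemma heat_flux_divergenceE t x :
  heat_flux_divergence t x =
  \sum_i partial i (fun y => a y * partial i (u t) y) x.
Proof.
rewrite /heat_flux_divergence /divergence; apply: eq_bigr => i _.
by congr (partial i _ x); apply/funext => y; rewrite !mxE.
Qed.

Lemma heat_divergence_strip : continuous_strip 0 T heat_flux_divergence.
Proof.
have C1a := smooth_C1_torus smooth_a.
apply: (@strip_eq _ _ _ _ (fun t x => \sum_i
    (a x * partial i (partial i (u t)) x + partial i a x * partial i (u t) x))).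
  move=> t x tT; rewrite heat_flux_divergenceE; apply: eq_bigr => i _.
  rewrite partialM//; first exact: (C1_derivable C1a).
  exact: (C1_derivable (heat_partial_C1 i tT)).
apply: strip_sum => i; apply: stripD; apply: stripM.
- exact: (strip_cst (C1_continuous C1a)).
- exact: heat_strip_xx.
- exact: (strip_cst (C1_partial C1a i)).
- exact: heat_strip_x.
Qed.

(** The source of a classical solution is continuous inside the cylinder, being
read off from the equation. *)
Lemma heat_source_strip : continuous_strip 0 T f.
Proof.
apply: (@strip_eq _ _ _ _
    (fun t x => derive1 (u^~ x) t - heat_flux_divergence t x)).
  by move=> t x tT; exact: (heat_equation sol).
apply: stripB; first exact: heat_strip_t.
exact: heat_divergence_strip.
Qed.

End heat_regularity.

(** With r = p - q the left side is 2 (- (a - b) q r - a r^2), at most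
2 k |q| |r| - 2 m r^2; the square of k |q| - 2 m |r| being nonnegative, this is
at most k^2 q^2 / (2 m).  Here p and q stand for the partial derivatives of the
two solutions. *)
Lemma young_flux (R : realType) (m k a b p q : R) : 0 < m -> m <= a ->
  `|a - b| <= k ->
  2 * (b * q * (p - q) - a * p * (p - q)) <= k ^+ 2 / (2 * m) * q ^+ 2.
Proof.
move=> m0 ma abk; set r := p - q.
have cross : - (a - b) * (q * r) <= k * (`|q| * `|r|).
  apply: (le_trans (ler_norm _)); rewrite !normrM normrN.
  by rewrite ler_wpM2r ?mulr_ge0.
have diag : m * r ^+ 2 <= a * r ^+ 2 by rewrite ler_wpM2r ?sqr_ge0.
have square := sqr_ge0 (k * `|q| - 2 * m * `|r|).
have sqn (x : R) : `|x| ^+ 2 = x ^+ 2 by rewrite real_normK ?num_real.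
rewrite [leRHS]mulrAC ler_pdivlMr ?mulr_gt0//.
have expand : (k * `|q| - 2 * m * `|r|) ^+ 2 =
    k ^+ 2 * q ^+ 2 - 4 * m * (k * (`|q| * `|r|)) + 4 * m ^+ 2 * r ^+ 2.
  by rewrite -(sqn q) -(sqn r); ring.
have -> : b * q * (p - q) - a * p * (p - q) = - (a - b) * (q * r) - a * r ^+ 2.
  by rewrite /r; ring.
rewrite expand in square.
have -> : 2 * (- (a - b) * (q * r) - a * r ^+ 2) * (2 * m) =
    (- (a - b) * (q * r) - a * r ^+ 2) * (4 * m) by ring.
have /le_trans : (- (a - b) * (q * r) - a * r ^+ 2) * (4 * m) <=
    (k * (`|q| * `|r|) - m * r ^+ 2) * (4 * m).
  by rewrite ler_pM2r ?mulr_gt0// lerB.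
apply; rewrite -subr_ge0.
by rewrite (_ : _ - _ = k ^+ 2 * q ^+ 2 - 4 * m * (k * (`|q| * `|r|)) +
  4 * m ^+ 2 * r ^+ 2)//; ring.
Qed.

Section energy.
Context d (X : measurableType d) (R : realType) (n : nat)
  (mu : {measure set X -> \bar R}) (B : set X) (pt : X -> 'rV[R]_n).
Context (cell : periodic_cell mu B pt).
Local Notation I := (cell_integral mu B pt).

(** Integration by parts in every direction, without boundary terms. *)
Lemma green_identity T a f u0 u (phi : 'rV[R]_n -> R) t : smooth_torus a ->
  heat_solution T a f u0 u -> 0 < t < T -> C1_torus phi ->
  I (fun x => phi x * heat_flux_divergence a u t x) =
  - I (fun x => \sum_i a x * partial i (u t) x * partial i phi x).
Proof.
move=> sa sol tT C1phi.
have C1F i : C1_torus (fun y => a y * partial i (u t) y).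
  apply: C1_torusM; first exact: smooth_C1_torus.
  exact: (heat_partial_C1 sol).
rewrite (_ : (fun x => phi x * _) = (fun x => \sum_i
    phi x * partial i (fun y => a y * partial i (u t) y) x)); last first.
  by apply/funext => x; rewrite heat_flux_divergenceE mulr_sumr.
rewrite (cell_integral_sum cell); last first.
  by move=> i x; exact: (cvgM (C1_continuous C1phi x) (C1_partial (C1F i) i x)).
rewrite (cell_integral_sum cell); last first.
  by move=> i x; exact: (cvgM (C1_continuous (C1F i) x) (C1_partial C1phi i x)).
rewrite -sumrN; apply: eq_bigr => i _.
rewrite (integration_by_parts_cell cell _ C1phi (C1F i)); congr (- I _).
by apply/funext => x; rewrite mulrC.
Qed.

Lemma energy_derive (T : R) (v : R -> 'rV[R]_n -> R) :
  continuous_strip 0 T v ->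
  (forall t x, 0 < t < T -> derivable (v^~ x) t 1) ->
  continuous_strip 0 T (fun t x => derive1 (v^~ x) t) ->
  forall t, 0 < t < T ->
    is_derive t 1 (fun t => I (fun x => v t x * v t x))
      (2 * I (fun x => v t x * derive1 (v^~ x) t)).
Proof.
move=> cv dv cdv t tT.
have dvv r x : 0 < r < T ->
    derive1 (fun s => v s x * v s x) r = 2 * (v r x * derive1 (v^~ x) r).
  move=> rT; rewrite !derive1E (deriveM (dv r x rT) (dv r x rT)).
  by rewrite /GRing.scale/=; ring.
have cvdv : continuous_strip 0 T (fun t x => v t x * derive1 (v^~ x) t).
  exact: stripM.
have c2vdv : continuous_strip 0 T (fun t x => 2 * (v t x * derive1 (v^~ x) t)).
  by apply: (stripM _ cvdv); apply: (@strip_cst _ _ _ _ (fun=> 2));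
    exact: cst_continuous.
rewrite -(cell_integralZ cell); last exact: (strip_slice cvdv tT).
rewrite (_ : (fun x => 2 * _) =
    (fun x => derive1 (fun s => v s x * v s x) t)); last first.
  by apply/funext => x; rewrite dvv.
apply: (cell_integral_derive cell (h := fun t x => v t x * v t x) _ _ _ tT).
- exact: stripM.
- by move=> r x rT; exact: (derivableM (dv r x rT) (dv r x rT)).
- by apply: strip_eq c2vdv => r x rT; rewrite dvv.
Qed.


(** The left side is the time derivative of the energy of [u].  By the equation
and Green's identity it is - 2 int a |grad u|^2 + 2 int u f; coercivity bounds
the first term, 2 u f <= u^2 + f^2 the second. *)
Lemma energy_inequality T m a f u0 u t : smooth_torus a ->
  (forall x, m <= a x) -> heat_solution T a f u0 u -> 0 < t < T ->
  2 * I (fun x => u t x * derive1 (u^~ x) t) <=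
  - (2 * m) * I (fun x => \sum_i partial i (u t) x ^+ 2)
  + I (fun x => u t x * u t x) + I (fun x => f t x * f t x).
Proof.
move=> sa ma sol tT.
have C1u := heat_C1 sol tT.
have cu := C1_continuous C1u.
have cf := strip_slice (heat_source_strip sa sol) tT.
have cdiv := strip_slice (heat_divergence_strip sa sol) tT.
have ca := C1_continuous (smooth_C1_torus sa).
have cp := C1_partial C1u.
have cuu : continuous (fun x => u t x * u t x).
  by move=> x; exact: (cvgM (cu x) (cu x)).
have cff : continuous (fun x => f t x * f t x).
  by move=> x; exact: (cvgM (cf x) (cf x)).
have cuf : continuous (fun x => u t x * f t x).
  by move=> x; exact: (cvgM (cu x) (cf x)).
have cudiv : continuous (fun x => u t x * heat_flux_divergence a u t x).
  by move=> x; exact: (cvgM (cu x) (cdiv x)).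
have capp : continuous (fun x => \sum_i a x * partial i (u t) x * partial i (u t) x).
  move=> x; apply: (@cvg_sumr R _ (nbhs x)) => i.
  exact: (cvgM (cvgM (ca x) (cp i x)) (cp i x)).
have cpp : continuous (fun x => \sum_i partial i (u t) x ^+ 2).
  move=> x; apply: (@cvg_sumr R _ (nbhs x)) => i.
  exact: (cvgM (cp i x) (cp i x)).
have -> : (fun x => u t x * derive1 (u^~ x) t) =
    (fun x => u t x * heat_flux_divergence a u t x + u t x * f t x).
  apply/funext => x; rewrite -mulrDr -(heat_equation sol x tT).
  by rewrite addrC subrK.
rewrite (cell_integralD cell)// (green_identity sa sol tT C1u).
have coercive : m * I (fun x => \sum_i partial i (u t) x ^+ 2) <=
    I (fun x => \sum_i a x * partial i (u t) x * partial i (u t) x).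
  rewrite -(cell_integralZ cell)//; apply: (le_cell_integral cell) => //.
    exact: (continuous_cstM cpp).
  apply: aeW => s _; rewrite mulr_sumr; apply: ler_sum => i _.
  by rewrite -mulrA -expr2 ler_wpM2r ?sqr_ge0.
have young : 2 * I (fun x => u t x * f t x) <=
    I (fun x => u t x * u t x) + I (fun x => f t x * f t x).
  rewrite -(cell_integralZ cell)// -(cell_integralD cell)//.
  apply: (le_cell_integral cell).
  - exact: (continuous_cstM cuf).
  - by move=> x; exact: (cvgD (cuu x) (cff x)).
  - apply: aeW => s _; have := sqr_ge0 (u t (pt s) - f t (pt s)).
    by rewrite sqrrB -mulr_natl !expr2; lra.
lra.
Qed.

(** The source cancels in the difference of the two equations, and what is left
after Green's identity is bounded pointwise by [young_flux].  The bound on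
[a - b] is assumed almost everywhere only, which is what the essential
supremum provides. *)
Lemma difference_energy_inequality T m k a b f u0 ua ub t : 0 < m ->
  smooth_torus a -> smooth_torus b -> (forall x, m <= a x) ->
  {ae mu, forall s, B s -> `|a (pt s) - b (pt s)| <= k} ->
  heat_solution T a f u0 ua -> heat_solution T b f u0 ub -> 0 < t < T ->
  2 * I (fun x => (ua t x - ub t x) *
                  derive1 (fun t => ua t x - ub t x) t) <=
  k ^+ 2 / (2 * m) * I (fun x => \sum_i partial i (ub t) x ^+ 2).
Proof.
move=> m0 sa sb ma abk sola solb tT.
have C1ua := heat_C1 sola tT.
have C1ub := heat_C1 solb tT.
have C1w := C1_torusB C1ua C1ub.
have ca := C1_continuous (smooth_C1_torus sa).
have cb := C1_continuous (smooth_C1_torus sb).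
have cw := C1_continuous C1w.
have cpa := C1_partial C1ua.
have cpb := C1_partial C1ub.
have cpw := C1_partial C1w.
have cdiva := strip_slice (heat_divergence_strip sa sola) tT.
have cdivb := strip_slice (heat_divergence_strip sb solb) tT.
set w := fun x => ua t x - ub t x in C1w cw cpw *.
have cwa : continuous (fun x => w x * heat_flux_divergence a ua t x).
  by move=> x; exact: (cvgM (cw x) (cdiva x)).
have cwb : continuous (fun x => w x * heat_flux_divergence b ub t x).
  by move=> x; exact: (cvgM (cw x) (cdivb x)).
have csa : continuous (fun x => \sum_i a x * partial i (ua t) x * partial i w x).
  move=> x; apply: (@cvg_sumr R _ (nbhs x)) => i.
  exact: (cvgM (cvgM (ca x) (cpa i x)) (cpw i x)).
have csb : continuous (fun x => \sum_i b x * partial i (ub t) x * partial i w x).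
  move=> x; apply: (@cvg_sumr R _ (nbhs x)) => i.
  exact: (cvgM (cvgM (cb x) (cpb i x)) (cpw i x)).
have cpp : continuous (fun x => \sum_i partial i (ub t) x ^+ 2).
  move=> x; apply: (@cvg_sumr R _ (nbhs x)) => i.
  exact: (cvgM (cpb i x) (cpb i x)).
have -> : (fun x => (ua t x - ub t x) * derive1 (fun t => ua t x - ub t x) t) =
    (fun x => w x * heat_flux_divergence a ua t x +
              (-1) * (w x * heat_flux_divergence b ub t x)).
  apply/funext => x; rewrite mulN1r -mulrBr; congr (_ * _).
  have -> : derive1 (fun t => ua t x - ub t x) t =
      derive1 (ua^~ x) t - derive1 (ub^~ x) t.
    rewrite !derive1E deriveB//; first exact: (heat_derivable_t sola).
    exact: (heat_derivable_t solb).
  have -> : derive1 (ua^~ x) t = f t x + heat_flux_divergence a ua t x.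
    by rewrite -(heat_equation sola x tT) subrK.
  have -> : derive1 (ub^~ x) t = f t x + heat_flux_divergence b ub t x.
    by rewrite -(heat_equation solb x tT) subrK.
  by rewrite opprD addrACA subrr add0r.
have cNwb : continuous (fun x => (-1) * (w x * heat_flux_divergence b ub t x)).
  exact: (continuous_cstM cwb).
have cNsa : continuous
    (fun x => (-1) * (\sum_i a x * partial i (ua t) x * partial i w x)).
  exact: (continuous_cstM csa).
rewrite (cell_integralD cell cwa cNwb) (cell_integralZ cell _ cwb).
rewrite [X in X + _](green_identity sa sola tT C1w).
rewrite [X in _ + _ * X](green_identity sb solb tT C1w).
rewrite mulN1r opprK -mulN1r -(cell_integralZ cell _ csa).
rewrite -(cell_integralD cell cNsa csb).
have csab : continuous
    (fun x => (-1) * (\sum_i a x * partial i (ua t) x * partial i w x) +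
              \sum_i b x * partial i (ub t) x * partial i w x).
  by move=> x; exact: (cvgD (cNsa x) (csb x)).
rewrite -(cell_integralZ cell _ csab) -(cell_integralZ cell _ cpp).
apply: (le_cell_integral cell).
- exact: (continuous_cstM csab).
- exact: (continuous_cstM cpp).
- apply: filterS abk => s abk Bs.
  rewrite mulN1r addrC -sumrB !mulr_sumr; apply: ler_sum => i _.
  have -> : partial i w (pt s) = partial i (ua t) (pt s) - partial i (ub t) (pt s).
    by rewrite partialB//; [exact: (C1_derivable C1ua)|exact: (C1_derivable C1ub)].
  have := abk Bs; have := ma (pt s).
  move: (partial i (ua t) (pt s)) (partial i (ub t) (pt s)) (a (pt s)) (b (pt s)).
  move=> pa q x y mx xyk; exact: young_flux.
Qed.

End energy.

(** * The difference of two solutions at a fixed time *)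

Section growth.
Context {R : realType}.
Local Notation leb := (@lebesgue_measure R).

Lemma growth_bound (T N : R) (phi dphi psi : R -> R) :
  (forall t, 0 < t < T -> is_derive t 1 phi (dphi t)) ->
  (forall t, 0 < t < T -> {for t, continuous dphi}) ->
  (forall t, 0 < t < T -> {for t, continuous psi}) ->
  (forall t, 0 < t < T -> dphi t <= psi t) ->
  (forall s t, 0 < s -> s < t -> t < T ->
    (\int[leb]_(r in `[s, t]) (psi r)%:E <= N%:E)%E) ->
  forall s t, 0 < s -> s < t -> t < T -> phi t <= phi s + N.
Proof.
move=> phiD dphic psic dphi_psi psiN s t s0 st tT.
have cst (g : R -> R) : (forall t, 0 < t < T -> {for t, continuous g}) ->
    {within `[s, t], continuous g}.
  move=> cg; apply: continuous_in_subspaceT => r.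
  rewrite inE/= in_itv/= => /andP[sr rt]; apply: cg.
  by rewrite (lt_le_trans s0 sr) (le_lt_trans rt tT).
have phic r : 0 < r < T -> {for r, continuous phi}.
  move=> rT; apply/differentiable_continuous/derivable1_diffP.
  exact: (@ex_derive _ _ _ _ _ _ _ (phiD r rT)).
have FTC : (\int[leb]_(r in `[s, t]) (dphi r)%:E = (phi t)%:E - (phi s)%:E)%E.
  apply: continuous_FTC2 => //; first exact: cst.
  - split.
    + move=> r; rewrite in_itv/= => /andP[sr rt].
      have rT : 0 < r < T by rewrite (lt_trans s0 sr) (lt_trans rt tT).
      exact: (@ex_derive _ _ _ _ _ _ _ (phiD r rT)).
    + by apply: cvg_at_right_filter; apply: phic; rewrite s0 (lt_trans st tT).
    + by apply: cvg_at_left_filter; apply: phic; rewrite (lt_trans s0 st).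
  - move=> r; rewrite in_itv/= => /andP[sr rt].
    have rT : 0 < r < T by rewrite (lt_trans s0 sr) (lt_trans rt tT).
    by rewrite derive1E; exact: (@derive_val _ _ _ _ _ _ _ (phiD r rT)).
have intc (g : R -> R) : (forall t, 0 < t < T -> {for t, continuous g}) ->
    leb.-integrable `[s, t] (EFin \o g).
  move=> cg; apply: continuous_compact_integrable; first exact: segment_compact.
  exact: cst.
rewrite -lerBlDl -lee_fin EFinB -FTC; apply: le_trans (psiN s t s0 st tT).
apply: le_integral => //; [exact: intc|exact: intc|].
move=> r; rewrite inE/= in_itv/= => /andP[sr rt]; rewrite lee_fin dphi_psi//.
by rewrite (lt_le_trans s0 sr) (le_lt_trans rt tT).
Qed.

End growth.

Section stability.
Context d (X : measurableType d) (R : realType) (n : nat)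
  (mu : {measure set X -> \bar R}) (B : set X) (pt : X -> 'rV[R]_n).
Context (cell : periodic_cell mu B pt).
Local Notation I := (cell_integral mu B pt).
Local Notation leb := (@lebesgue_measure R).

Lemma clamped_energy_continuous (T : R) (v : R -> 'rV[R]_n -> R) : 0 < T ->
  {within [set p : R * 'rV[R]_n | 0 <= p.1 <= T],
    continuous (fun p : R * 'rV[R]_n => v p.1 p.2)} ->
  continuous (fun t => I (fun x => v (clamp T t) x * v (clamp T t) x)).
Proof.
move=> T0 cv t.
have cV := clamped_continuous (ltW T0) cv.
apply: (@cell_integral_continuous _ _ _ _ _ _ _ cell (t - 1) (t + 1)
  (fun t x => v (clamp T t) x * v (clamp T t) x)).
  by apply: (@stripM _ _ _ _ (fun t x => v (clamp T t) x)
    (fun t x => v (clamp T t) x)) => p _; exact: cV.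
by rewrite gtrBl ltr01 ltrDl ltr01.
Qed.

(** The energy estimate.  The weight [c] is chosen so that c (2 m) = k^2 / (2 m):
as the exponential [e] is at least 1, the gradient term of [energy_inequality]
then absorbs that of [difference_energy_inequality].  The derivative of [e]
removes the term |ub|^2. *)
Lemma difference_bound (T m k N : R) a b f u0 ua ub : 0 < T -> 0 < m ->
  smooth_torus a -> smooth_torus b ->
  (forall x, m <= a x) -> (forall x, m <= b x) ->
  {ae mu, forall s, B s -> `|a (pt s) - b (pt s)| <= k} ->
  heat_solution T a f u0 ua -> heat_solution T b f u0 ub ->
  (forall s t, 0 < s -> s < t -> t < T ->
    (\int[leb]_(r in `[s, t]) (I (fun x => f r x * f r x))%:E <= N%:E)%E) ->
  forall t, 0 <= t <= T ->
    I (fun x => (ua t x - ub t x) * (ua t x - ub t x)) <=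
    k ^+ 2 * (expR T / (2 * m) ^+ 2 * (I (fun x => u0 x * u0 x) + N)).
Proof.
move=> T0 m0 sa sb ma mb abk sola solb fN.
pose w t x := ua t x - ub t x.
pose W t := I (fun x => w t x * w t x).
pose E t := I (fun x => ub t x * ub t x).
pose G t := I (fun x => \sum_i partial i (ub t) x ^+ 2).
pose F t := I (fun x => f t x * f t x).
pose dW t := 2 * I (fun x => w t x * derive1 (w^~ x) t).
pose dE t := 2 * I (fun x => ub t x * derive1 (ub^~ x) t).
pose c := k ^+ 2 / (2 * m) ^+ 2.
have c0 : 0 <= c by rewrite divr_ge0 ?sqr_ge0.
pose e t := expR (T - t).
pose Phi t := W t + c * (e t * E t).
pose dPhi t := dW t + c * (e t * dE t + E t * (- e t)).
have cub := heat_strip solb.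
have cua := heat_strip sola.
have cw : continuous_strip 0 T w by exact: stripB.
have dub t x : 0 < t < T -> derivable (ub^~ x) t 1 by exact: (heat_derivable_t solb).
have dua t x : 0 < t < T -> derivable (ua^~ x) t 1 by exact: (heat_derivable_t sola).
have dw t x : 0 < t < T -> derivable (w^~ x) t 1.
  by move=> tT; exact: (derivableB (dua t x tT) (dub t x tT)).
have cdub := heat_strip_t solb.
have cdw : continuous_strip 0 T (fun t x => derive1 (w^~ x) t).
  apply: strip_eq (stripB (heat_strip_t sola) cdub) => t x tT.
  by rewrite !derive1E (deriveB (dua t x tT) (dub t x tT)).
have cf := heat_source_strip sb solb.
have e_derive (t : R) : is_derive t 1 e (- e t).
  have Tt : is_derive t 1 (fun s : R => T - s) (-1).
    have := is_deriveB (is_derive_cst T t 1) (is_derive_id t 1).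
    by rewrite sub0r.
  have := @is_derive1_comp R expR (fun s => T - s) t _ _ (is_derive_expR (T - t)) Tt.
  by rewrite mulrN1.
have ce : continuous e.
  move=> t; apply/differentiable_continuous/derivable1_diffP.
  exact: (@ex_derive _ _ _ _ _ _ _ (e_derive t)).
have PhiD (t : R) : 0 < t < T -> is_derive t 1 Phi (dPhi t).
  move=> tT.
  have WD := energy_derive cell cw dw cdw tT.
  have ED := energy_derive cell cub dub cdub tT.
  exact: (is_deriveD WD (is_deriveZ c (is_deriveM (e_derive t) ED))).
have cE t : 0 < t < T -> {for t, continuous E}.
  by apply: (cell_integral_continuous cell); exact: stripM.
have cdE t : 0 < t < T -> {for t, continuous dE}.
  move=> tT; apply: continuous_at_cstM.
  exact: (cell_integral_continuous cell (stripM cub cdub) tT).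
have cdW t : 0 < t < T -> {for t, continuous dW}.
  move=> tT; apply: continuous_at_cstM.
  exact: (cell_integral_continuous cell (stripM cw cdw) tT).
have cF t : 0 < t < T -> {for t, continuous F}.
  by apply: (cell_integral_continuous cell); exact: stripM.
have cdPhi t : 0 < t < T -> {for t, continuous dPhi}.
  move=> tT; apply: (cvgD (cdW t tT)).
  apply: (@continuous_at_cstM R R c (fun t => e t * dE t + E t * - e t)).
  exact: (cvgD (cvgM (ce t) (cdE t tT)) (cvgM (cE t tT) (cvgN (ce t)))).
have G0 t : 0 <= G t.
  by apply: cell_integral_ge0 => x; apply: sumr_ge0 => i _; exact: sqr_ge0.
have F0 t : 0 <= F t.
  by apply: cell_integral_ge0 => x; rewrite -expr2 sqr_ge0.
have dPhi_le t : 0 < t < T -> dPhi t <= c * expR T * F t.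
  move=> tT.
  have hE := energy_inequality cell sb mb solb tT.
  have hW := difference_energy_inequality cell m0 sa sb ma abk sola solb tT.
  have cm : c * (2 * m) = k ^+ 2 / (2 * m) by rewrite /c; field; exact: lt0r_neq0.
  have e1 : 1 <= e t by rewrite /e -expR0 ler_expR subr_ge0; case/andP: tT => _ /ltW.
  have eT : e t <= expR T by rewrite /e ler_expR gerBl; case/andP: tT => /ltW.
  have h1 : c * (e t * dE t) <= c * (e t * (- (2 * m) * G t + E t + F t)).
    by apply: (ler_wpM2l c0); apply: ler_wpM2l; [exact: expR_ge0|exact: hE].
  have h2 : k ^+ 2 / (2 * m) * G t <= k ^+ 2 / (2 * m) * G t * e t.
    by rewrite ler_peMr// mulr_ge0// -cm; apply: mulr_ge0 => //;
      rewrite ltW// mulr_gt0.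
  have h3 : c * F t * e t <= c * F t * expR T by rewrite ler_wpM2l// mulr_ge0.
  have h4 : c * (e t * (- (2 * m) * G t + E t + F t)) =
      - (k ^+ 2 / (2 * m) * G t * e t) + c * (e t * E t) + c * F t * e t.
    by rewrite -cm; ring.
  have -> : dPhi t = dW t + c * (e t * dE t) - c * (e t * E t).
    by rewrite /dPhi; ring.
  rewrite -/(dW t) -/(G t) in hW.
  have -> : c * expR T * F t = c * F t * expR T by ring.
  move: h1 h2 h3 hW; rewrite h4; lra.
have step s t : 0 < s -> s < t -> t < T -> Phi t <= Phi s + c * expR T * N.
  apply: (growth_bound PhiD cdPhi _ dPhi_le) => {s t}.
    by move=> t tT; apply: continuous_at_cstM; exact: cF.
  move=> s t s0 st tT; under eq_integral do rewrite EFinM.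
  rewrite integralZl//=; last first.
    apply: continuous_compact_integrable; first exact: segment_compact.
    apply: continuous_in_subspaceT => r; rewrite inE/= in_itv/= => /andP[sr rt].
    by apply: cF; rewrite (lt_le_trans s0 sr) (le_lt_trans rt tT).
  rewrite [leRHS]EFinM; apply: lee_wpmul2l; last exact: fN.
  by rewrite lee_fin; apply: (mulr_ge0 c0); exact: expR_ge0.
(* [Phic] extends [Phi] continuously to 0 and T, where the equation is not
   available *)
pose Wc t := W (clamp T t).
pose Ec t := E (clamp T t).
pose Phic t := Wc t + c * (e t * Ec t).
have cWc : continuous Wc.
  apply: (clamped_energy_continuous T0); apply/subspace_continuousP => p pT.
  have /subspace_continuousP wa := heat_continuous sola.
  have /subspace_continuousP wb := heat_continuous solb.
  exact: (cvgB (wa p pT) (wb p pT)).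
have cEc : continuous Ec.
  exact: clamped_energy_continuous T0 (heat_continuous solb).
have cPhic : continuous Phic.
  move=> t; apply: (cvgD (cWc t)).
  apply: (@continuous_at_cstM R R c (fun t => e t * Ec t)).
  exact: (cvgM (ce t) (cEc t)).
have PhicE t : 0 < t < T -> Phic t = Phi t.
  by move=> /andP[t0 tT]; rewrite /Phic /Wc /Ec clamp_id// !ltW.
have Phi0 : Phic 0 = c * expR T * I (fun x => u0 x * u0 x).
  rewrite /Phic /Wc /Ec clamp_id ?lexx ?ltW// /W /E /w /e subr0 -mulrA.
  rewrite (_ : I _ = 0) ?add0r; last first.
    rewrite -[RHS](mul0r (I (fun=> 0))) -(cell_integralZ cell); last first.
      exact: cst_continuous.
    congr (I _); apply/funext => x.
    by rewrite (heat_initial sola) (heat_initial solb) subrr !mul0r.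
  congr (_ * (_ * I _)); apply/funext => x.
  by rewrite (heat_initial solb).
(* the limit s -> 0 in [step] *)
have late t : 0 < t < T -> Phic t <= Phic 0 + c * expR T * N.
  move=> /[dup] tT /andP[t0 t_lt_T].
  have /(_ 0) : forall s, 0 <= s <= t -> - Phic s <= c * expR T * N - Phic t.
    apply: (continuous_le_itvcc t0).
      by move=> s; exact: (cvgN (cPhic s)).
    move=> s /andP[s0 st]; rewrite !PhicE//; last by rewrite s0 (lt_trans st).
    by have := step s t s0 st t_lt_T; lra.
  by rewrite lexx (ltW t0) => /(_ isT); lra.
move=> t tT.
have -> : I (fun x => (ua t x - ub t x) * (ua t x - ub t x)) = Wc t.
  by rewrite /Wc clamp_id.
have : Wc t <= Phic t.
  rewrite /Phic lerDl; apply: (mulr_ge0 c0).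
  apply: mulr_ge0; first exact: expR_ge0.
  by apply: cell_integral_ge0 => x; rewrite -expr2 sqr_ge0.
move=> /le_trans; apply.
have := continuous_le_itvcc T0 cPhic late tT.
rewrite Phi0 /c => /le_trans; apply.
by rewrite le_eqVlt; apply/orP; left; apply/eqP; ring.
Qed.

End stability.

(** * Norms and the stability theorem *)

Section norms.
Context d (X : measurableType d) (R : realType) (n : nat)
  (mu : {measure set X -> \bar R}) (B : set X) (pt : X -> 'rV[R]_n).
Context (cell : periodic_cell mu B pt) (mB : measurable B).
Local Notation I := (cell_integral mu B pt).
Local Notation leb := (@lebesgue_measure R).

(** With the measure of either cell, [cell_norm] and [cylinder_norm] are
convertible to the norms [Lx_norm] and [LtLx_norm] of the torus. *)
Definition cell_norm (p : \bar R) (g : 'rV[R]_n -> R) : \bar R :=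
  Lnorm (mrestr mu mB) p (fun s => (g (pt s))%:E).

Definition cylinder_norm (T : R) (h : R -> 'rV[R]_n -> R) : \bar R :=
  Lnorm (mrestr leb (measurable_segment T)) 2%:E (fun t => cell_norm 2%:E (h t)).

Lemma cell_norm2_sqr g : continuous g ->
  (cell_norm 2%:E g ^+ 2 = (I (fun x => g x * g x))%:E)%E.
Proof.
move=> cg; rewrite /cell_norm Lnorm2_sqr.
have cgg : continuous (fun x => g x * g x) by move=> x; exact: (cvgM (cg x) (cg x)).
rewrite /cell_integral /Rintegral fineK//.
exact: (integrable_fin_num mB (cell_integrable cell cgg)).
Qed.

Lemma cylinder_norm_sqr T h :
  (cylinder_norm T h ^+ 2 =
   \int[leb]_(t in `[0%R, T]) (cell_norm 2%:E (h t) ^+ 2))%E.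
Proof. exact: Lnorm2_sqr. Qed.

Lemma cell_norm_infty_ae (k : R) g : cell_norm +oo%E g = k%:E ->
  {ae mu, forall s, B s -> `|g (pt s)| <= k}.
Proof.
rewrite /cell_norm unlock.
have -> : (0 < mrestr mu mB [set: X])%E.
  by rewrite /= /mrestr setTI (cell_mass cell) lte_fin.
move=> supk.
have [A [mA A0 hA]] := ess_sup_ge (mrestr mu mB) (abse \o (fun s => (g (pt s))%:E)).
exists (A `&` B); split => //; first exact: measurableI.
move=> s /= /not_implyP[Bs gk]; split => //; apply: hA => /=.
by rewrite supk lee_fin.
Qed.

Lemma cylinder_norm_source (T N : R) a f u0 u : smooth_torus a ->
  heat_solution T a f u0 u -> (cylinder_norm T f ^+ 2 = N%:E)%E ->
  forall s t, 0 < s -> s < t -> t < T ->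
    (\int[leb]_(r in `[s, t]) (I (fun x => f r x * f r x))%:E <= N%:E)%E.
Proof.
move=> sa sol <- s t s0 st tT; rewrite cylinder_norm_sqr.
have cf := heat_source_strip sa sol.
apply: ge0_subset_le_integral.
- move=> r _; rewrite lee_fin; apply: cell_integral_ge0 => x.
  by rewrite -expr2 sqr_ge0.
- by move=> r _; apply: expe_ge0; exact: Lnorm_ge0.
- move=> r; rewrite /= !in_itv/= => /andP[sr rt].
  by rewrite (le_trans (ltW s0) sr) (le_trans rt (ltW tT)).
- move=> r rst.
  have /andP[sr rt] : s <= r <= t by move: rst; rewrite /= in_itv.
  rewrite cell_norm2_sqr//.
  by apply: (strip_slice cf); rewrite (lt_le_trans s0 sr) (le_lt_trans rt tT).
Qed.

Lemma solution_slice_continuous (T : R) (a : 'rV[R]_n -> R) f u0 u (t : R) :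
  heat_solution T a f u0 u ->
  0 <= t <= T -> continuous (u t).
Proof.
move=> sol tT; have T0 : 0 <= T by case/andP: tT; exact: le_trans.
have cV := clamped_continuous T0 (heat_continuous sol).
rewrite -(clamp_id tT).
apply: (@strip_slice R n (t - 1) (t + 1) (fun t x => u (clamp T t) x)).
  by move=> p _; exact: cV.
by rewrite gtrBl ltr01 ltrDl ltr01.
Qed.

(** Squares of norms are integrals, so [difference_bound] integrated over
[0, T] bounds the square of the norm by c T k^2.  Adding 1 to the square root
of c T makes the constant positive, which settles the case where the norm of
a - b is infinite. *)
Lemma heat_stability (T m : R) (f : R -> 'rV[R]_n -> R) (u0 : 'rV[R]_n -> R) :
  0 < T -> 0 < m -> (cylinder_norm T f < +oo)%E ->
  exists C : R, forall (a b : 'rV[R]_n -> R) (ua ub : R -> 'rV[R]_n -> R),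
    smooth_torus a -> smooth_torus b ->
    (forall x, m <= a x) -> (forall x, m <= b x) ->
    heat_solution T a f u0 ua -> heat_solution T b f u0 ub ->
    (cylinder_norm T (fun t x => (ua t x - ub t x)%R)
       <= C%:E * cell_norm +oo (fun x => (a x - b x)%R))%E.
Proof.
move=> T0 m0 foo.
have f0 : (0 <= cylinder_norm T f)%E by exact: Lnorm_ge0.
pose N := fine (cylinder_norm T f ^+ 2)%E.
have NE : (cylinder_norm T f ^+ 2 = N%:E)%E.
  by rewrite /N; move: foo f0; case: cylinder_norm => // r _ _; rewrite -EFin_expe.
have N0 : 0 <= N by apply: fine_ge0; exact: expe_ge0.
pose c := expR T / (2 * m) ^+ 2 * (I (fun x => u0 x * u0 x) + N).
have c0 : 0 <= c.
  rewrite mulr_ge0 ?divr_ge0 ?expR_ge0 ?sqr_ge0// addr_ge0//.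
  by apply: cell_integral_ge0 => x; rewrite -expr2 sqr_ge0.
exists (Num.sqrt (c * T) + 1) => a b ua ub sa sb ma mb sola solb.
set C := Num.sqrt (c * T) + 1.
have C0 : 0 < C by rewrite ltr_pwDr// sqrtr_ge0.
have CcT : c * T <= C ^+ 2.
  have cT0 : 0 <= c * T by rewrite mulr_ge0// ltW.
  rewrite -[leLHS]sqr_sqrtr// ler_pXn2r ?nnegrE ?sqrtr_ge0 ?ltW//.
  by rewrite /C ltrDl.
have : (0 <= cell_norm +oo (fun x => (a x - b x)%R))%E by exact: Lnorm_ge0.
case E : (cell_norm _ _) => [k| |//]; rewrite ?lee_fin => k0; last first.
  by rewrite gt0_muley ?lte_fin// leey.
have bound := difference_bound cell T0 m0 sa sb ma mb (cell_norm_infty_ae E)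
  sola solb (cylinder_norm_source sb solb NE).
have : (cylinder_norm T (fun t x => (ua t x - ub t x)%R) ^+ 2 <=
        ((C * k) ^+ 2)%:E)%E.
  rewrite cylinder_norm_sqr.
  apply: (@le_trans _ _ (\int[leb]_(t in `[0%R, T]) (k ^+ 2 * c)%:E)%E).
    apply: ge0_subset_le_integral => //.
    - by move=> r _; apply: expe_ge0; exact: Lnorm_ge0.
    - by move=> r _; rewrite lee_fin mulr_ge0// sqr_ge0.
    - move=> r r0T; have rT : 0 <= r <= T by move: r0T; rewrite /= in_itv.
      rewrite cell_norm2_sqr.
        by rewrite lee_fin bound.
      have ca := solution_slice_continuous sola rT.
      have cb := solution_slice_continuous solb rT.
      by move=> x; exact: (cvgB (ca x) (cb x)).
  rewrite integral_cst//= lebesgue_measure_itv/= lte_fin T0 oppr0 adde0.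
  rewrite -EFinM lee_fin exprMn -mulrA mulrC.
  by rewrite ler_wpM2r// sqr_ge0.
have : (0 <= cylinder_norm T (fun t x => (ua t x - ub t x)%R))%E.
  exact: Lnorm_ge0.
have Ck0 : 0 <= C * k by rewrite mulr_ge0// ltW.
case: cylinder_norm => [r| |]//.
by rewrite -EFin_expe -EFinM !lee_fin => r0; rewrite ler_pXn2r ?nnegrE.
Qed.

End norms.

Lemma torus_inf_lb (R : realType) n (g h : 'rV[R]_n -> R) (m : R) :
  m%:E = Order.min (torus_inf g) (torus_inf h) ->
  (forall x, m <= g x) /\ (forall x, m <= h x).
Proof.
move=> mE; have : (m%:E <= Order.min (torus_inf g) (torus_inf h))%E.
  by rewrite mE.
rewrite le_min => /andP[mg mh]; split => x; rewrite -lee_fin.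
- by apply: (le_trans mg); apply: ereal_inf_lbound; exists x.
- by apply: (le_trans mh); apply: ereal_inf_lbound; exists x.
Qed.

Theorem lemma2p2 (R : realType) (D : torus) (T m M : R)
    (f : R -> 'rV[R]_(torus_dim D) -> R) (u0 : 'rV[R]_(torus_dim D) -> R)
    (T_gt0 : 0 < T) (m_gt0 : 0 < m)
    (f_periodic : forall t : R, 0 <= t -> torus_periodic (f t))
    (f_L2 : in_LtLx T f)
    (u0_smooth : smooth_torus u0) :
  exists C : R,
  forall (a b : 'rV[R]_(torus_dim D) -> R) (ua ub : R -> 'rV[R]_(torus_dim D) -> R),
    smooth_torus a -> (forall x, 0 <= a x) ->
    smooth_torus b -> (forall x, 0 <= b x) ->
    m%:E = Order.min (torus_inf a) (torus_inf b) ->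
    M%:E = torus_sup (fun x => a x + b x) ->
    heat_solution T a f u0 ua ->
    heat_solution T b f u0 ub ->
    (LtLx_norm T (fun t x => (ua t x - ub t x)%R)
       <= C%:E * Lx_norm +oo (fun x => (a x - b x)%R))%E.
Proof.
case: D f u0 f_periodic f_L2 u0_smooth => f u0 _ [_ f_finite] _.
- have [C stable] := heat_stability (@periodic_cell1 R)
    (mB := @measurable_segment R 1) u0 T_gt0 m_gt0 f_finite.
  exists C => a b ua ub sa _ sb _ /torus_inf_lb[ma mb] _ sola solb.
  exact: (stable a b ua ub).
- have [C stable] := heat_stability (@periodic_cell2 R)
    (mB := @measurable_square R) u0 T_gt0 m_gt0 f_finite.
  exists C => a b ua ub sa _ sb _ /torus_inf_lb[ma mb] _ sola solb.
  exact: (stable a b ua ub).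
Qed.
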